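(* Let $k\geq 0$ be an integer and let $G$ be a $k$-gap-planar graph. Then for every integer $r\geq 0$, $$\widetilde{\nabla}_r(G)\leq 8\sqrt{(2r+1)(k+1)}.$$
   Context: All graphs are simple, finite and undirected. A drawing of a graph $G$ in the plane represents each vertex by a distinct point and each edge $vw$ by a non-self-intersecting curve between the points of $v$ and $w$, such that no three edges cross at a single point. A drawing is $k$-gap-planar if every crossing can be charged to one of the two edges involved so that at most $k$ crossings are charged to each edge; a graph is $k$-gap-planar if it has a $k$-gap-planar drawing in the plane. The density of a graph $G$ is $|E(G)|/|V(G)|$ if $V(G)\neq\emptyset$, and $0$ otherwise. A $(\leq c)$-subdivision of a graph $H$ is a graph obtained from $H$ by replacing each edge by a path with at most $c$ internal (new) vertices, internally disjoint paths for distinct edges. A graph $H$ is an $r$-shallow topological minor of $G$ if some $(\leq 2r)$-subdivision of $H$ is a subgraph of $G$. $\widetilde{\nabla}_r(G)$ denotes the maximum density of an $r$-shallow topological minor of $G$. *)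

(* Defs.v *)
From HB Require Import structures.
From mathcomp Require Import all_boot all_order all_algebra.
From mathcomp Require Import all_classical all_reals.
From mathcomp Require Import topology normedtype.
From mathcomp Require Import Rstruct Rstruct_topology.
Set Implicit Arguments. Unset Strict Implicit. Unset Printing Implicit Defensive.
Import Order.TTheory GRing.Theory Num.Theory.
Import numFieldNormedType.Exports.
Local Open Scope classical_set_scope.
Local Open Scope ring_scope.

Notation RR := Rdefinitions.R.
Notation point := 'rV[RR]_2.

Section Drawing.
Variables (T : finType) (e : rel T).

Definition is_edge (E : {set T}) : Prop :=
  exists x y, e x y /\ E = [set x; y]%SET.

Definition on_edge (gam : T -> T -> RR -> point) (E : {set T}) (p : point) : Prop :=
  exists x y, [/\ e x y, E = [set x; y]%SET &
    exists t : RR, [/\ 0 < t, t < 1 & gam x y t = p]].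

Definition drawing (pos : T -> point) (gam : T -> T -> RR -> point) : Prop :=
  [/\ injective pos,
      (forall x y, e x y ->
        [/\ {within `[0, 1], continuous (gam x y)},
            {in `[0, 1] &, injective (gam x y)},
            gam x y 0 = pos x, gam x y 1 = pos y &
            forall t, gam y x t = gam x y (1 - t)]),
      (forall x y z t, e x y -> 0 < t -> t < 1 -> gam x y t <> pos z) &
      (forall E1 E2 E3 p, is_edge E1 -> is_edge E2 -> is_edge E3 ->
         E1 <> E2 -> E1 <> E3 -> E2 <> E3 ->
         ~ [/\ on_edge gam E1 p, on_edge gam E2 p & on_edge gam E3 p])].

Definition crossing (gam : T -> T -> RR -> point) (p : point) : Prop :=
  exists E1 E2, [/\ E1 <> E2, on_edge gam E1 p & on_edge gam E2 p].

Definition k_gap_planar_drawing (k : nat) (pos : T -> point)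
    (gam : T -> T -> RR -> point) : Prop :=
  drawing pos gam /\
  exists ch : point -> {set T},
    (forall p, crossing gam p -> on_edge gam (ch p) p) /\
    (forall E (s : seq point), uniq s ->
       (forall p, p \in s -> crossing gam p /\ ch p = E) -> (size s <= k)%N).

Definition k_gap_planar (k : nat) : Prop :=
  exists pos gam, k_gap_planar_drawing k pos gam.

(* H (simple graph on 'I_n) is an r-shallow topological minor of G:
   some (<= 2r)-subdivision of H is a subgraph of G. Each edge uv (u < v) of H
   is realised by a path phi u, P u v, phi v with at most 2r internal vertices. *)
Definition shallow_top_minor (r n : nat) (eH : rel 'I_n) : Prop :=
  exists phi : 'I_n -> T, injective phi /\
  exists P : 'I_n -> 'I_n -> seq T,
    (forall u v : 'I_n, (u < v)%N -> eH u v ->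
       [/\ path e (phi u) (rcons (P u v) (phi v)), uniq (P u v),
           (size (P u v) <= 2 * r)%N &
           forall w, phi w \notin P u v]) /\
    (forall u v u' v' : 'I_n, (u < v)%N -> eH u v -> (u' < v')%N -> eH u' v' ->
       (u, v) != (u', v') -> forall x, x \in P u v -> x \notin P u' v').
End Drawing.

Definition num_edges n (eH : rel 'I_n) : nat :=
  #|([set uv : 'I_n * 'I_n | (uv.1 < uv.2)%N && eH uv.1 uv.2])%SET|.

Definition density n (eH : rel 'I_n) : RR :=
  if n == 0%N then 0 else (num_edges eH)%:R / n%:R.

(* Main.v *)
Require Import Defs.
From HB Require Import structures.
From Stdlib Require Import Btauto.
From mathcomp Require Import all_classical all_reals.
From mathcomp Require Import topology normedtype.
From mathcomp Require Import Rstruct Rstruct_topology.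
From mathcomp Require Import all_boot all_order all_algebra.
From mathcomp Require Import lra ring zify.
Set Implicit Arguments. Unset Strict Implicit. Unset Printing Implicit Defensive.
Import Order.TTheory GRing.Theory Num.Theory.
Import numFieldNormedType.Exports.

(** An edge of the minor H follows at most 2r+1 edges of G, so its curve carries
at most (2r+1)k charged crossings and at most (2r+1)k|E(H)| pairs of
vertex-disjoint edges of H have intersecting curves.  The crossing-lemma
argument (delete a random set of vertices, then one edge per remaining
intersecting pair) then gives the bound, with sampling probability 1/q for
q = floor (2 sqrt ((2r+1)k+1)), provided that |E| <= 3|V| for every graph drawn
so that vertex-disjoint edges have disjoint curves; edges sharing an endpoint
may cross each other and edges may cross themselves.

By compactness such curves may be replaced by finite chains of points with
small steps, the chains of vertex-disjoint edges staying far apart.  This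
discrete notion is preserved by contracting edges.  Mader's argument shows that
a nonempty minor-minimal graph with |E| >= 3|V| - 1 contains K5 after at most
one more contraction, and K5 is excluded by parity: joining consecutive points
of the chains by L-shaped paths, the number of crossings between the 15 pairs of
disjoint edges of K5 is odd. *)

(** * Crossing parity of chains *)

Section Parity.
Variables (X : eqType) (u v : X -> X -> bool).

(* [u] and [v] compare first and second coordinates.  [lcross a a' b b'] is the
   parity of the crossings between the path going from [a] horizontally and then
   vertically to [a'] and the similar path from [b] to [b']. *)
Definition lcross a a' b b' :=
  (u a b' (+) u a' b') && (v a b (+) v a b')
  (+) (u a' b (+) u a' b') && (v a b (+) v a' b).

Fixpoint xsum (h : X -> X -> bool) a s :=
  if s is a' :: s' then h a a' (+) xsum h a' s' else false.

(* Crossings of a chain with the rightward ([ray]) or leftward ([coray])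
   horizontal ray from a point. *)
Definition ray b t a := xsum (fun b b' => u a b' && (v a b (+) v a b')) b t.
Definition coray a s b := xsum (fun a a' => u a' b && (v a b (+) v a' b)) a s.

(** The contribution of one step from [b] to [b'] is the sum of the two ray terms and of a
    difference between [b] and [b'] of [u a' b && (v a b (+) v a' b)]. That difference telescopes
    along the chain, leaving its values at the two ends. *)
Lemma lcross_chain a a' b t :
  xsum (lcross a a') b t =
  ray b t a (+) ray b t a' (+) (u a' b && (v a b (+) v a' b))
  (+) (u a' (last b t) && (v a (last b t) (+) v a' (last b t))).
Proof.
elim: t b => [|b' t IH] b /=; first by rewrite addbb.
rewrite IH /ray /lcross /=; move: (xsum _ _ t) (xsum _ _ t) (u a' (last b' t)) => r r' w.
move: (v a (last b' t)) (v a' (last b' t)) => w1 w2.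
by case: (u a b') (u a' b') (u a' b) (v a b) (v a b') (v a' b) (v a' b') r r' w w1 w2
  => [] [] [] [] [] [] [] [] [] [] [] [].
Qed.

Definition xcross a s b t := xsum (fun a a' => xsum (lcross a a') b t) a s.

(** Summing over the first chain, the ray terms telescope to its ends and the end terms add up to
    corays. The crossing parity is thus read off at the four endpoints. *)
Lemma xcross_boundary a s b t :
  xcross a s b t = ray b t a (+) ray b t (last a s)
                   (+) coray a s b (+) coray a s (last b t).
Proof.
rewrite /xcross; elim: s a => [|a' s IH] a /=; first by rewrite addbb.
rewrite IH lcross_chain /coray /=.
set x1 := ray _ _ _; set x2 := ray _ _ _; set x3 := ray _ _ _.
set x4 := _ && _; set x5 := _ && _; set x6 := xsum _ _ _; set x7 := xsum _ _ _.
by case: x1 x2 x3 x4 x5 x6 x7 => [] [] [] [] [] [] [].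
Qed.

Definition flips x b := u x b = ~~ u b x /\ v x b = ~~ v b x.

(** The ray and the coray from [b] form a full horizontal line, which a chain crosses an odd number
    of times exactly when its ends lie on different sides. [flips] says that comparison with [b] is
    never a tie. *)
Lemma corayE a s b :
  (forall x, x \in a :: s -> flips x b) ->
  coray a s b = ray a s b (+) v b a (+) v b (last a s).
Proof.
elim: s a => [|a' s IH] a Hx /=; first by rewrite /= addbb.
have [_ Ha] := Hx a (mem_head _ _).
have [Hu' Ha'] : flips a' b by apply: Hx; rewrite !inE eqxx orbT.
rewrite /coray /ray /= -/(coray a' s b) -/(ray a' s b) IH; last first.
  by move=> x xs; apply: Hx; rewrite inE xs orbT.
rewrite Hu' Ha Ha'; move: (ray _ _ _) (v b (last _ _)) => r w.
by case: (u b a') (v b a) (v b a') r w => [] [] [] [] [].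
Qed.

Lemma xcrossE a s b t a1 b1 : last a s = a1 -> last b t = b1 ->
  (forall x, x \in a :: s -> flips x b /\ flips x b1) ->
  xcross a s b t = ray b t a (+) ray b t a1 (+) (ray a s b (+) v b a (+) v b a1)
    (+) (ray a s b1 (+) v b1 a (+) v b1 a1).
Proof.
by move=> <- <- Hx; rewrite xcross_boundary !corayE // => x /Hx[].
Qed.

(** In the sum over the 15 disjoint pairs, the ray from [p k] against the chain [i j] occurs twice,
    once for each of the two edges at [k] avoiding [i] and [j], and cancels. Each comparison of two
    vertices occurs six times; orienting them by [V] leaves an odd number of negations, since
    precisely the five interleaving pairs, those crossing in a convex pentagon, contribute three
    each. *)
Lemma xcross_K5 (p : nat -> X) (c : nat -> nat -> seq X) :
  (forall i j, i < j < 5 -> last (p i) (c i j) = p j) ->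
  (forall i j, i < j < 5 -> flips (p j) (p i)) ->
  (forall i j k x, i < j < 5 -> k < 5 -> k != i -> k != j ->
     x \in p i :: c i j -> flips x (p k)) ->
  (forall i j k l, i < j < 5 -> k < l < 5 -> uniq [:: i; j; k; l] ->
     xcross (p i) (c i j) (p k) (c k l) = false) -> False.
Proof.
move=> Hl Hp Hf Hc.
have V i j : i < j < 5 -> v (p j) (p i) = ~~ v (p i) (p j) by move=> /Hp[].
(* The identity is phrased with [xorb] because the final sum is settled by [btauto]. *)
have H i j k l : i < j < 5 -> k < l < 5 -> uniq [:: i; j; k; l] ->
   xorb (xorb (xorb (ray (p k) (c k l) (p i)) (ray (p k) (c k l) (p j)))
   (xorb (xorb (ray (p i) (c i j) (p k)) (v (p k) (p i))) (v (p k) (p j))))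
    (xorb (xorb (ray (p i) (c i j) (p l)) (v (p l) (p i))) (v (p l) (p j))) = false.
  have xorbE x y : xorb x y = x (+) y by case: x y => [] [].
  move=> ij kl un; rewrite !xorbE -(Hc i j k l) //.
  rewrite (xcrossE (Hl _ _ ij) (Hl _ _ kl)) // => x xA.
  move: un; rewrite /= !inE !negb_or => /and4P[/and3P[_ ik il] /andP[jk jl] _ _].
  have [k5 l5] : k < 5 /\ l < 5.
    by case/andP: kl => kl l5; split=> //; apply: ltn_trans l5.
  by split; apply: Hf xA; rewrite // eq_sym.
have := H 0 1 2 3 isT isT isT.
have := H 0 1 2 4 isT isT isT.
have := H 0 1 3 4 isT isT isT.
have := H 0 2 1 3 isT isT isT.
have := H 0 2 1 4 isT isT isT.
have := H 0 2 3 4 isT isT isT.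
have := H 0 3 1 2 isT isT isT.
have := H 0 3 1 4 isT isT isT.
have := H 0 3 2 4 isT isT isT.
have := H 0 4 1 2 isT isT isT.
have := H 0 4 1 3 isT isT isT.
have := H 0 4 2 3 isT isT isT.
have := H 1 2 3 4 isT isT isT.
have := H 1 3 2 4 isT isT isT.
have := H 1 4 2 3 isT isT isT.
rewrite (V 0 1) // (V 0 2) // (V 0 3) // (V 0 4) // (V 1 2) // (V 1 3) //.
rewrite (V 1 4) // (V 2 3) // (V 2 4) // (V 3 4) //.
set e1 := xorb _ _; move=> h1; set e2 := xorb _ _; move=> h2; set e3 := xorb _ _; move=> h3.
set e4 := xorb _ _; move=> h4; set e5 := xorb _ _; move=> h5; set e6 := xorb _ _; move=> h6.
set e7 := xorb _ _; move=> h7; set e8 := xorb _ _; move=> h8; set e9 := xorb _ _; move=> h9.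
set e10 := xorb _ _; move=> h10; set e11 := xorb _ _; move=> h11; set e12 := xorb _ _; move=> h12.
set e13 := xorb _ _; move=> h13; set e14 := xorb _ _; move=> h14; set e15 := xorb _ _; move=> h15.
have : xorb e1 (xorb e2 (xorb e3 (xorb e4 (xorb e5 (xorb e6 (xorb e7 (xorb e8 
  (xorb e9 (xorb e10 (xorb e11 (xorb e12 (xorb e13 (xorb e14 e15))))))))))))) = true.
  rewrite /e1 /e2 /e3 /e4 /e5 /e6 /e7 /e8 /e9 /e10 /e11 /e12 /e13 /e14 /e15; btauto.
by rewrite h1 h2 h3 h4 h5 h6 h7 h8 h9 h10 h11 h12 h13 h14 h15.
Qed.
End Parity.

(** * Chains of points in the plane and the exclusion of K5 *)

Section ChainK5.
Local Open Scope ring_scope.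
Variable R : realDomainType.
Implicit Types (eps : R).

Definition epsclose eps : rel 'rV[R]_2 :=
  [rel a b : 'rV[R]_2 | [forall j : 'I_2, `|a 0 j - b 0 j| < eps]].

Lemma epsclose_sym eps : symmetric (epsclose eps).
Proof. by move=> a b; apply: eq_forallb => j; rewrite distrC. Qed.

Lemma epscloseE eps a b :
  epsclose eps a b = (`|a 0 ord0 - b 0 ord0| < eps) && (`|a 0 ord_max - b 0 ord_max| < eps).
Proof.
apply/forallP/andP => [H|[H0 H1] j]; first by split.
have -> : j = if val j == 0%N then ord0 else ord_max by case: j => [[|[|//]] ?]; apply: val_inj.
by case: ifP.
Qed.

(* Equal coordinates are compared by the labels, which puts chains with
   disjoint label sets in general position. *)
Definition lexlt (j : 'I_2) (a b : 'rV[R]_2 * nat) :=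
  (a.1 0 j < b.1 0 j) || ((a.1 0 j == b.1 0 j) && (a.2 < b.2)%N).

Lemma lexltN j a b : a.2 != b.2 -> lexlt j a b = ~~ lexlt j b a.
Proof.
rewrite /lexlt neq_ltn; case: (ltgtP (a.1 0 j) (b.1 0 j)) => //= _.
by case: ltngtP.
Qed.

Lemma lexlt_between_l j a a' c :
  lexlt j a c (+) lexlt j a' c -> `|a.1 0 j - c.1 0 j| <= `|a.1 0 j - a'.1 0 j|.
Proof.
rewrite /lexlt; move: (a.1 0 j) (a'.1 0 j) (c.1 0 j) => x y z.
move: (ler_norm (x - y)) (ler_norm (- (x - y))); rewrite normrN ler_norml => h1 h2.
case: (ltgtP x z) => xz; case: (ltgtP y z) => yz => //= _;
  apply/andP; split; lra.
Qed.

Lemma lexlt_between_r j a c c' :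
  lexlt j a c (+) lexlt j a c' -> `|a.1 0 j - c'.1 0 j| <= `|c.1 0 j - c'.1 0 j|.
Proof.
rewrite /lexlt; move: (a.1 0 j) (c.1 0 j) (c'.1 0 j) => x y z.
move: (ler_norm (y - z)) (ler_norm (- (y - z))); rewrite normrN ler_norml => h1 h2.
case: (ltgtP x z) => xz; case: (ltgtP x y) => xy => //= _;
  apply/andP; split; lra.
Qed.

Local Notation cross := (lcross (lexlt ord0) (lexlt ord_max)).

(** If the horizontal part from [a] meets the vertical part into [b'], each coordinate of [a] and
    [b'] differs by at most the length of a step, so [a] and [b'] are close. The other kind of
    crossing makes [a'] and [b] close. *)
Lemma lcross_far eps a a' b b' :
  epsclose eps a.1 a'.1 -> epsclose eps b.1 b'.1 ->
  ~~ epsclose eps a.1 b'.1 -> ~~ epsclose eps a'.1 b.1 -> cross a a' b b' = false.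
Proof.
move=> aa bb far1 far2; move: (aa) (bb); rewrite !epscloseE => /andP[aa0 aa1] /andP[bb0 bb1].
move: aa bb; rewrite (epsclose_sym eps a.1 a'.1) (epsclose_sym eps b.1 b'.1) !epscloseE => /andP[a'a0 a'a1] /andP[b'b0 b'b1].
rewrite /lcross.
case H1: (_ && _).
  case/andP: H1 => /lexlt_between_l H0 /lexlt_between_r H1.
  by case/negP: far1; rewrite epscloseE (le_lt_trans H0) // (le_lt_trans H1).
apply/negbTE/negP => /= /andP[]; rewrite addbC => /lexlt_between_r H0.
rewrite addbC => /lexlt_between_l H2.
by case/negP: far2; rewrite epscloseE (le_lt_trans H0) // (le_lt_trans H2).
Qed.

Local Notation step eps := (relpre fst (epsclose eps)).

Lemma xcross_far eps a s b t :
  path (step eps) a s -> path (step eps) b t ->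
  (forall x y, x \in a :: s -> y \in b :: t -> ~~ epsclose eps x.1 y.1) ->
  xcross (lexlt ord0) (lexlt ord_max) a s b t = false.
Proof.
rewrite /xcross; elim: s a => [//|a' s IH] a /= /andP[aa' ps] pt far.
rewrite IH // ?addbF => [|x y xs yt]; last by apply: far; rewrite // inE xs orbT.
have {IH ps} farA x y : x \in [:: a; a'] -> y \in b :: t -> ~~ epsclose eps x.1 y.1.
  by move=> xa; apply: far; move: xa; rewrite !inE => /orP[] ->; rewrite ?orbT.
elim: t b pt farA {far} => [//|b' t IH] b /= /andP[bb' pt] far.
rewrite IH // ?addbF => [|x y xs yt]; last by apply: far; rewrite // inE yt orbT.
by apply: lcross_far aa' bb' _ _; apply: far; rewrite !inE eqxx ?orbT.
Qed.

Lemma chain_K5 eps (p : nat -> 'rV[R]_2) (s : nat -> nat -> seq 'rV[R]_2) :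
  (forall i j, (i < j < 5)%N -> path (epsclose eps) (p i) (rcons (s i j) (p j))) ->
  (forall i j k l x y, (i < j < 5)%N -> (k < l < 5)%N -> uniq [:: i; j; k; l] ->
     x \in p i :: rcons (s i j) (p j) -> y \in p k :: rcons (s k l) (p l) ->
     ~~ epsclose eps x y) -> False.
Proof.
move=> chain far.
(* Inner points take the label of the first endpoint, so the chain [i j] uses only the labels [i]
   and [j] and never ties with a point labelled by another vertex. *)
pose c i j := rcons [seq (x, i) | x <- s i j] (p j, j).
have cE i j : p i :: rcons (s i j) (p j) = map fst ((p i, i) :: c i j).
  by rewrite /c /= map_rcons -map_comp map_id.
have lab i j x : x \in (p i, i) :: c i j -> x.2 = i \/ x.2 = j.
  rewrite /c inE mem_rcons inE => /or3P[/eqP->|/eqP->|/mapP[y _ ->]] /=; by [left|right].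
have flipsI (x y : 'rV[R]_2 * nat) : x.2 != y.2 -> flips (lexlt ord0) (lexlt ord_max) x y.
  by move=> xy; split; apply: lexltN.
apply: (@xcross_K5 _ (lexlt ord0) (lexlt ord_max) (fun i => (p i, i)) c).
- by move=> i j _; rewrite /c last_rcons.
- by move=> i j /andP[ij _]; apply: flipsI; rewrite /= neq_ltn ij orbT.
- move=> i j k x _ _ ki kj /lab xij; apply: flipsI => /=.
  by case: xij => ->; rewrite eq_sym.
- move=> i j k l ij kl un; apply: (@xcross_far eps).
  + by have := chain i j ij; rewrite -path_map /c map_rcons -map_comp map_id.
  + by have := chain k l kl; rewrite -path_map /c map_rcons -map_comp map_id.
  + by move=> x y xc yc; apply: far ij kl un _ _; rewrite cE; apply: map_f.
Qed.
End ChainK5.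

(** * Weak drawings and Mader's bound *)

Section WeakDrawing.
Variables (R : realDomainType) (eps : R) (V : finType).
Implicit Types (e : rel V) (D : {set V}).

Definition chain (p : V -> 'rV[R]_2) (s : V -> V -> seq 'rV[R]_2) x y :=
  p x :: rcons (s x y) (p y).

(* No condition is imposed on the chains of edges sharing an endpoint: this is
   what makes the notion stable under edge contraction. *)
Definition weak_drawing e := exists p s,
  (forall x y, e x y -> path (epsclose eps) (p x) (rcons (s x y) (p y))) /\
  (forall a b c d x y, e a b -> e c d -> uniq [:: a; b; c; d] ->
     x \in chain p s a b -> y \in chain p s c d -> ~~ epsclose eps x y).

Lemma weak_drawing_sub e e' : subrel e' e -> weak_drawing e -> weak_drawing e'.
Proof.
move=> sub [p [s [ch far]]]; exists p, s; split=> [x y /sub/ch//|].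
by move=> a b c d x y /sub ab /sub cd; apply: far.
Qed.

Lemma weak_drawing_K5 e (z : seq V) :
  weak_drawing e -> size z = 5 -> uniq z -> pairwise e z -> False.
Proof.
move=> [p [s [ch far]]] sz uz ez.
have [x0 _] : exists x0 : V, true by case: z sz {uz ez} => // x; exists x.
have E i j : i < j < 5 -> e (nth x0 z i) (nth x0 z j).
  move=> /andP[ij j5]; move/(pairwiseP x0): ez; apply=> //; rewrite inE sz //.
  exact: ltn_trans j5.
apply: (@chain_K5 _ eps (fun i => p (nth x0 z i))
         (fun i j => s (nth x0 z i) (nth x0 z j))).
- by move=> i j /E; apply: ch.
- move=> i j k l x y ij kl un; apply: far; rewrite ?E //.
  rewrite -(map_inj_in_uniq (f := fun i => nth x0 z i)) // in un.
  move=> i1 i2; rewrite !inE => H1 H2 /eqP; rewrite nth_uniq ?sz //; first by move/eqP.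
  + by move: H1; lia.
  + by move: H2; lia.
Qed.

(** The vertex [y] is merged into [x] but stays in the vertex type, isolated; the guards [b != x]
    and [a != x] prevent a loop at [x]. *)
Definition contract_edge x y e : rel V := [rel a b |
  [&& a != y, b != y & [|| e a b, [&& a == x, b != x & e y b]
                                | [&& b == x, a != x & e a y]]]].

Lemma contract_edge_sym x y e : symmetric e -> symmetric (contract_edge x y e).
Proof.
move=> es a b; rewrite /contract_edge /= [e b a]es [e y a]es [e b y]es.
by case: (a != y); case: (b != y) => //=; rewrite [X in _ || X]orbC.
Qed.

Lemma contract_edge_irr x y e : irreflexive e -> irreflexive (contract_edge x y e).
Proof.
by move=> ei a; rewrite /contract_edge /= ei; case: (a == x); rewrite /= ?andbF.
Qed.

(** An edge that [x] inherits from [y] is drawn by following the chain of [x y] and then the old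
    chain at [y]. Such edges all share [x], so no separation between their chains has to be
    checked. *)
Lemma weak_drawing_contract_edge x y e :
  symmetric e -> irreflexive e -> e x y -> weak_drawing e -> weak_drawing (contract_edge x y e).
Proof.
move=> es ei exy [p [s [ch far]]].
have nxy : x != y by apply/eqP => E; rewrite E ei in exy.
exists p, (fun a b => if e a b then s a b else
  if a == x then s x y ++ p y :: s y b else s a y ++ p y :: s y x); split.
  move=> a b /and3P[ay b_y]; case: ifP => [/ch //|_ /=].
  case: eqP => [-> /= ebx|_ /= /andP[/eqP-> eay]].
    have {ebx}eyb : e y b by move: ebx; rewrite andbF orbF => /andP[].
    by rewrite rcons_cat rcons_cons -cat_rcons cat_path last_rcons ch //= ch.
  by rewrite rcons_cat rcons_cons -cat_rcons cat_path last_rcons ch //= ch // es.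
set s' := fun a b => _.
have cover a b z : contract_edge x y e a b -> z \in chain p s' a b ->
    exists a' b', [/\ e a' b', z \in chain p s a' b',
      {subset [:: a'; b'] <= [:: a; b; y]} &
      (x != a) && (x != b) -> (a' = a) /\ (b' = b)].
  move=> /and3P[ay b_y]; rewrite /s' /chain; case: ifP => [eab _ zin|_ /=].
    by exists a, b; split=> // t; rewrite !inE => /orP[] ->; rewrite ?orbT.
  case: eqP => [-> /= ebx|_ /= /andP[/eqP-> eay]].
    have {ebx}eyb : e y b by move: ebx; rewrite andbF orbF => /andP[].
    rewrite rcons_cat rcons_cons -cat_rcons -cat_cons mem_cat => /orP[] zin.
      exists x, y; split=> //; last by rewrite eqxx.
      by move=> t; rewrite !inE => /orP[] ->; rewrite ?orbT.
    exists y, b; split=> //; last by rewrite eqxx.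
      by rewrite inE zin orbT.
    by move=> t; rewrite !inE => /orP[] ->; rewrite ?orbT.
  rewrite rcons_cat rcons_cons -cat_rcons -cat_cons mem_cat => /orP[] zin.
    exists a, y; split=> //; last by rewrite eqxx andbF.
    by move=> t; rewrite !inE => /orP[] ->; rewrite ?orbT.
  exists y, x; split=> //; last by rewrite eqxx andbF.
  + by rewrite es.
  + by rewrite inE zin orbT.
  + by move=> t; rewrite !inE => /orP[] ->; rewrite ?orbT.
move=> a b c d u v eab ecd un uin vin.
have [a' [b' [eab' uin' sub1 eq1]]] := cover _ _ _ eab uin.
have [c' [d' [ecd' vin' sub2 eq2]]] := cover _ _ _ ecd vin.
apply: (far _ _ _ _ _ _ eab' ecd' _ uin' vin').
have nab : a' != b' by apply/eqP => E; rewrite E ei in eab'.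
have ncd : c' != d' by apply/eqP => E; rewrite E ei in ecd'.
have [ay b_y cy dy] : [/\ a != y, b != y, c != y & d != y].
  by case/and3P: eab => -> -> _; case/and3P: ecd => -> -> _.
(* At most one of two disjoint edges ends at [x], so at most one is rerouted through [y]; the old
   edges found by [cover] are then vertex-disjoint too. *)
have dab : [|| (x != a) && (x != b) | (x != c) && (x != d)].
  move: un; rewrite /= !inE !negb_or; case: (eqVneq x a) => [<-|xa] /=.
    by case: (x == c); case: (x == d); rewrite ?andbF.
  case: (eqVneq x b) => [<-|//] /=.
    by case: (x == c); case: (x == d); rewrite ?andbF.
have {sub1} : a' \in [:: a; b; y] /\ b' \in [:: a; b; y].
  by split; apply: sub1; rewrite !inE eqxx ?orbT.
have {sub2} : c' \in [:: c; d; y] /\ d' \in [:: c; d; y].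
  by split; apply: sub2; rewrite !inE eqxx ?orbT.
rewrite /= !inE !negb_or nab ncd.
move=> [c'in d'in] [a'in b'in].
move: un; rewrite /= !inE !negb_or => /and4P[/and3P[_ ac ad] /andP[bc bd] _ _].
have mem1 t w : t \in [:: a; b; y] -> w \in [:: c; d] -> t != w.
  rewrite !inE => /or3P[]/eqP-> /orP[]/eqP->; rewrite // eq_sym //.
have mem2 t w : t \in [:: a; b] -> w \in [:: c; d; y] -> t != w.
  rewrite !inE => /orP[]/eqP-> /or3P[]/eqP->; rewrite // eq_sym //.
case/orP: dab => [/eq1[-> ->]|/eq2[-> ->]]; rewrite !andbT.
  by rewrite !mem2 // !inE ?eqxx ?orbT.
by rewrite !mem1 // !inE ?eqxx ?orbT.
Qed.

End WeakDrawing.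

(** * Degree sums under deletion and contraction *)

Section Density.
Variables (V : finType).
Implicit Types (e : rel V) (D : {set V}).

Definition nbr e x := [set y | e x y].
(** The degree sum, hence twice the number of edges for a simple graph supported on [D]. *)
Definition vol D e := \sum_(x in D) #|nbr e x|.
Definition supported D e := forall x y, e x y -> (x \in D) && (y \in D).

Lemma sum_mem_card D (A : {set V}) : \sum_(a in D) (a \in A : nat) <= #|A|.
Proof.
rewrite (eq_bigr (fun a => if a \in A then 1 else 0)); last by move=> a _; case: ifP.
by rewrite -big_mkcondr sum1_card subset_leq_card //; apply/subsetP => a /andP[].
Qed.

Definition delete v e : rel V := [rel a b | [&& a != v, b != v & e a b]].

Lemma vol_delete D e v : symmetric e -> v \in D ->
  vol D e <= vol (D :\ v) (delete v e) + 2 * #|nbr e v|.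
Proof.
move=> es vD; rewrite /vol (big_setD1 v) //= mul2n -addnn addnA addnC leq_add2r.
apply: leq_trans (leq_add (leqnn _) (sum_mem_card (D :\ v) (nbr e v))).
rewrite -big_split /=; apply: leq_sum => a; rewrite !inE => /andP[av _].
rewrite (cardsD1 v) addnC inE es leq_add2r subset_leq_card //.
by apply/subsetP => b; rewrite !inE /delete /= av.
Qed.

(** Contraction loses the edge [x y] and identifies one pair of edges for each common neighbour;
    every lost edge counts twice in [vol]. *)
Lemma vol_contract_edge D e x y : symmetric e -> irreflexive e -> e x y ->
  x \in D -> y \in D ->
  vol D e <= vol (D :\ y) (contract_edge x y e) + 2 * #|nbr e x :&: nbr e y| + 2.
Proof.
move=> es ei exy xD yD.
have nxy : x != y by apply/eqP => E; rewrite E ei in exy.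
have yDx : y \in D :\ x by rewrite !inE eq_sym nxy.
have xDy : x \in D :\ y by rewrite !inE nxy.
rewrite /vol (big_setD1 x) //= (big_setD1 y) //= (big_setD1 x (A := D :\ y)) //=.
have -> : D :\ y :\ x = D :\ x :\ y by rewrite !setDDl setUC.
have Hx : #|nbr e x| + #|nbr e y| <= #|nbr (contract_edge x y e) x| + 2 + #|nbr e x :&: nbr e y|.
  rewrite -cardsUI leq_add2r.
  have <- : #|[set x; y]| = 2 by rewrite cards2 nxy.
  apply: leq_trans (leq_card_setU _ _); apply/subset_leq_card/subsetP => b.
  rewrite !inE /contract_edge /= eqxx nxy /=.
  by case: (b == x); case: (b == y); rewrite /= ?orbT ?orbF // ?andbF ?orbF.
have Ha : \sum_(a in D :\ x :\ y) #|nbr e a| <=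
    \sum_(a in D :\ x :\ y) #|nbr (contract_edge x y e) a| + #|nbr e x :&: nbr e y|.
  apply: leq_trans (leq_add (leqnn _) (sum_mem_card (D :\ x :\ y) _)).
  rewrite -big_split /=; apply: leq_sum => a; rewrite !inE => /and3P[ay ax _].
  rewrite [e x a]es [e y a]es (cardsD1 y) inE.
  case eay : (e a y) => /=; last first.
    rewrite andbF addn0 add0n subset_leq_card //; apply/subsetP => b.
    by rewrite !inE /contract_edge /= ay => /andP[-> ->].
  case eax : (e a x) => /=.
    rewrite addnC leq_add2r subset_leq_card //; apply/subsetP => b.
    by rewrite !inE /contract_edge /= ay => /andP[-> ->].
  rewrite addn0; have <- : #|x |: (nbr e a :\ y)| = 1 + #|nbr e a :\ y|.
    by rewrite cardsU1 !inE eax andbF.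
  apply/subset_leq_card/subsetP => b; rewrite !inE /contract_edge /= ay.
  by case/orP => [/eqP-> | /andP[-> ->]]; rewrite ?eqxx ?nxy ?ax ?eay ?orbT.
lia.
Qed.

Definition delete_edge x y e : rel V :=
  [rel a b | [&& e a b, ~~ ((a == x) && (b == y)) & ~~ ((a == y) && (b == x))]].

Lemma vol_delete_edge D e x y : symmetric e -> irreflexive e -> e x y ->
  x \in D -> y \in D -> vol D e <= vol D (delete_edge x y e) + 2.
Proof.
move=> es ei exy xD yD.
have nxy : x != y by apply/eqP => E; rewrite E ei in exy.
apply: (@leq_trans (\sum_(a in D) (#|nbr (delete_edge x y e) a| + (a \in [set x; y])))).
  apply: leq_sum => a _.
  pose o := if a == x then y else x.
  apply: (@leq_trans #|nbr (delete_edge x y e) a :|: (if a \in [set x; y] then [set o] else set0)|).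
    apply/subset_leq_card/subsetP => b; rewrite !inE /delete_edge /o /= => -> /=.
    case: (eqVneq a x) => [->|ax] /=; rewrite ?(negPf nxy) ?inE /=; first by case: eqP.
    by case: (a == y) => //=; rewrite inE; case: eqP.
  apply: leq_trans (leq_card_setU _ _) _; rewrite leq_add2l.
  by case: (a \in _); rewrite ?cards1 ?cards0.
rewrite big_split /= leq_add2l; apply: leq_trans (sum_mem_card _ _) _.
by rewrite cards2 nxy.
Qed.

End Density.

(** * K5 near a vertex of degree four or five *)

Section Mader.
Variables (R : realDomainType) (eps : R) (V : finType).
Implicit Types (e : rel V) (D : {set V}).

(** With four neighbours, [v] and its neighbourhood form K5. With five, each neighbour misses at
    most one other, and contracting one edge inside the neighbourhood repairs the missing adjacency
    needed for K5. *)
Lemma dense_nbhd_no_drawing e v :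
  symmetric e -> irreflexive e -> weak_drawing eps e -> 3 < #|nbr e v| <= 5 ->
  (forall w, e v w -> 2 < #|nbr e v :&: nbr e w|) -> False.
Proof.
move=> es ei wd; set S := nbr e v => /andP[S4 S5] deg.
have vS w : w \in S -> e v w by rewrite inE.
(* The bound 2 counts [w] itself. *)
have nonadj w : w \in S -> #|S :\: nbr e w| <= 2.
  by move=> /vS /deg; rewrite -/S => H; move: (cardsID (nbr e w) S); lia.
move: S4; rewrite leq_eqVlt => /orP[/eqP S4|S5'].
  have adj w t : w \in S -> t \in S -> w != t -> e w t.
    move=> wS tS wt; apply/negPn/negP => net.
    have : 2 <= #|S :\: nbr e w|.
      have <- : #|[set w; t]| = 2 by rewrite cards2 wt.
      apply/subset_leq_card/subsetP => z; rewrite !inE.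
      by case/orP => /eqP->; rewrite ?ei ?net vS.
    by have := deg _ (vS _ wS); rewrite -/S; move: (cardsID (nbr e w) S); lia.
  apply: (@weak_drawing_K5 _ eps _ e (v :: enum S)) wd _ _ _.
  - by rewrite /= -cardE -S4.
  - by rewrite /= enum_uniq mem_enum inE ei.
  - rewrite /=; apply/andP; split.
      by apply/allP => w; rewrite mem_enum => /vS.
    have: uniq (enum S) by apply: enum_uniq.
    have: {subset enum S <= S} by move=> z; rewrite mem_enum.
    elim: (enum S) => //= z s IH sub /andP[zs us]; rewrite IH ?andbT //.
      apply/allP => t ts; apply: adj; rewrite ?sub ?inE ?eqxx ?ts ?orbT //.
      by apply: contraNneq zs => ->.
    by move=> t ts; apply: sub; rewrite inE ts orbT.
have {S5 S5'} S5 : #|S| = 5 by lia.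
have adj w t t' : w \in S -> t \in S -> t' \in S -> uniq [:: w; t; t'] ->
    ~~ e w t -> e w t'.
  move=> wS tS t'S /=; rewrite !inE negb_or => /and3P[/andP[wt wt'] tt' _] nwt.
  apply/negPn/negP => nwt'; have := nonadj _ wS; rewrite leqNgt => /negP; apply.
  have <- : #|[set w; t; t']| = 3 by rewrite setUC cardsU1 cards2 !inE negb_or ![t' == _]eq_sym wt wt' tt'.
  apply/subset_leq_card/subsetP => z; rewrite !inE -orbA.
  by case/or3P => /eqP->; rewrite ?ei ?nwt ?nwt' vS.
(* A non-adjacent pair is chosen if there is one, since its members are adjacent to all other
   neighbours; otherwise any pair has this property. *)
have [b [b' [bS b'S bb' adjb]]] : exists b b', [/\ b \in S, b' \in S, b != b' &
    forall t, t \in S -> t != b -> t != b' -> e b t /\ e b' t].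
  case: (boolP [exists b in S, exists b' in S, (b != b') && ~~ e b b']).
    case/exists_inP => b bS /exists_inP[b' b'S /andP[bb' nbb']].
    exists b, b'; split=> // t tS tb tb'; split.
      by apply: (adj _ b'); rewrite //= !inE negb_or bb' eq_sym tb eq_sym tb'.
    apply: (adj _ b); rewrite //= ?inE ?negb_or ?[b' == b]eq_sym ?bb' 1?eq_sym ?tb'.
      by rewrite eq_sym tb.
    by rewrite es.
  move=> none; have [b [b' [bS b'S bb']]] : exists b b', [/\ b \in S, b' \in S & b != b'].
    by apply/card_gt1P; rewrite S5.
  have all_adj w t : w \in S -> t \in S -> w != t -> e w t.
    move=> wS tS wt; apply/negPn/negP => net; case/negP: none.
    by apply/exists_inP; exists w => //; apply/exists_inP; exists t; rewrite ?wt.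
  by exists b, b'; split=> // t tS tb tb'; split; apply: all_adj; rewrite // eq_sym.
(* At most one pair among the three other neighbours is non-adjacent, so one of the three is
   adjacent to the other two. *)
have [a [c [c' [[aS cS c'S un] eac eac']]]] : exists a c c',
   [/\ [/\ a \in S, c \in S, c' \in S & uniq [:: a; b; b'; c; c']], e a c & e a c'].
  pose S3 := S :\ b :\ b'.
  have S3card : #|S3| = 3.
    move: S5; rewrite (cardsD1 b) bS (cardsD1 b') !inE [b' == b]eq_sym bb' /=.
    by rewrite vS // => - [].
  have memS3 z : z \in S3 -> [/\ z \in S, z != b & z != b'].
    by rewrite !inE => /and3P[-> -> ->].
  have [z1 [z2 [z3 [z1S z2S z3S uz]]]] : exists z1 z2 z3,
      [/\ z1 \in S3, z2 \in S3, z3 \in S3 & uniq [:: z1; z2; z3]].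
    have := enum_uniq S3; have := cardE S3; rewrite S3card.
    have : {subset enum S3 <= S3} by move=> z; rewrite mem_enum.
    case: (enum S3) => [|z1 [|z2 [|z3 [|]]]] //= sub _ uz; exists z1, z2, z3.
    by split=> //; apply: sub; rewrite !inE eqxx ?orbT.
  have perm x y z : x \in S3 -> y \in S3 -> z \in S3 -> uniq [:: x; y; z] ->
      [/\ x \in S, y \in S, z \in S & uniq [:: x; b; b'; y; z]].
    move=> /memS3[xS xb xb'] /memS3[yS yb yb'] /memS3[zS zb zb'] u3; split=> //.
    rewrite /= !inE !negb_or xb xb' bb' ![b == _]eq_sym ![b' == _]eq_sym yb zb yb' zb' /=.
    by move: u3; rewrite /= !inE negb_or.
  have u213 : uniq [:: z2; z1; z3] by rewrite -(perm_uniq (permEl (perm_catCA [:: z1] [:: z2] [:: z3]))).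
  have u312 : uniq [:: z3; z1; z2] by rewrite (perm_uniq (permEl (perm_catC [:: z3] [:: z1; z2]))).
  have [[[z1S' _ _] [z2S' _ _]] [z3S' _ _]] := (memS3 _ z1S, memS3 _ z2S, memS3 _ z3S).
  case e12 : (e z1 z2); last first.
    exists z3, z1, z2; split; first exact: perm.
      by rewrite es; apply: (adj _ z2); rewrite ?e12.
    by rewrite es; apply: (adj _ z1); rewrite // es e12.
  case e13 : (e z1 z3); first by exists z1, z2, z3; split; rewrite ?e12 ?e13 //; apply: perm.
  exists z2, z1, z3; split; first exact: perm; first by rewrite es.
  by rewrite es; apply: (adj _ z1); rewrite // es e13.
move: (un); rewrite /= !inE !negb_or => /and5P[/and4P[ab ab' ac ac'] /and3P[_ bc bc'] /andP[b'c b'c'] cc' _].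
have [[eba eb'a] [ebc eb'c] [ebc' eb'c']] : [/\ e b a /\ e b' a, e b c /\ e b' c & e b c' /\ e b' c'].
  by split; apply: adjb; rewrite // eq_sym.
(* Merging [c] into [b] makes [b] adjacent to [b'], because [c] is; then [v], [a], [b], [b'], [c']
   span K5. *)
have wdc := weak_drawing_contract_edge es ei ebc wd.
have vc : v != c by apply/eqP => E; have := vS _ cS; rewrite E ei.
have old x y : x != c -> y != c -> e x y -> contract_edge b c e x y.
  by rewrite /contract_edge /= => -> -> ->.
apply: (weak_drawing_K5 wdc (z := [:: v; a; b; b'; c'])) => //.
  have -> : uniq [:: v; a; b; b'; c'] = (v \notin [:: a; b; b'; c']) && uniq [:: a; b; b'; c'] by [].
  apply/andP; split; last by rewrite /= !inE !negb_or ab ab' ac' bb' bc' b'c'.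
  apply/negP => vin; have : v \in S; last by rewrite inE ei.
  by move: vin; rewrite in_cons in_cons in_cons mem_seq1 => /or4P[] /eqP {1}->.
have c'c : c' != c by rewrite eq_sym.
have bb'c : contract_edge b c e b b' by rewrite /contract_edge /= bc b'c eqxx (eq_sym b') bb' (es c) eb'c orbT.
rewrite /= bb'c !old // ?vS // 1?es //.
Qed.

End Mader.

(** * The linear edge bound for weak drawings *)

Section MaderBound.
Variables (R : realDomainType) (eps : R) (V : finType).
Implicit Types (e : rel V) (D : {set V}).

(** In a minimal counterexample, deleting a vertex of degree at most 3, or contracting an edge with
    at most 2 common neighbours, loses at most 6 from [vol] and one vertex, hence gives a smaller
    counterexample. So all degrees are at least 4 and each edge lies in at least 3 triangles. *)
Lemma weak_drawing_vol D e : D != set0 -> symmetric e -> irreflexive e ->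
  supported D e -> weak_drawing eps e -> vol D e + 3 <= 6 * #|D|.
Proof.
have volN D' e' : vol D' e' <= #|V| * #|V|.
  apply: (@leq_trans (\sum_(x in D') #|V|)); first by apply: leq_sum => a _; apply: max_card.
  by rewrite sum_nat_const leq_mul2r max_card orbT.
(* Weighting [#|D|] by [N] makes the measure drop whenever a vertex is removed,
   whatever happens to the edges. *)
pose N := (#|V| * #|V|).+1.
have [m] := ubnP (#|D| * N + vol D e); elim: m => // m IH in D e *.
rewrite ltnS => size_le D0 es ei eD wd; rewrite leqNgt; apply/negP => big.
have D_gt0 : 0 < #|D| by rewrite card_gt0.
have nbr_out v : nbr e v \subset D :\ v.
  apply/subsetP => w; rewrite !inE => evw; have /andP[_ ->] := eD _ _ evw.
  by rewrite andbT; apply: contraTneq evw => ->; rewrite ei.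
have deg4 v : v \in D -> 3 < #|nbr e v|.
  move=> vD; rewrite ltnNge; apply/negP => deg3.
  have := vol_delete es vD; set e' := delete v e => volv.
  have Dv : #|D| = (#|D :\ v|).+1 by rewrite (cardsD1 v) vD.
  have D'0 : D :\ v != set0.
    apply: contraTneq big => D'0; have := subset_leq_card (nbr_out v).
    rewrite D'0 cards0 leqn0 => /eqP deg0; move: Dv volv.
    by rewrite D'0 cards0 deg0 /vol big_set0; lia.
  suff H : vol (D :\ v) e' + 3 <= 6 * #|D :\ v| by lia.
  apply: IH => //; first by have := volN (D :\ v) e'; rewrite /N in size_le *; nia.
  - by move=> a b; rewrite /e' /delete /= es; case: (a != v); case: (b != v).
  - by move=> a; rewrite /e' /delete /= ei !andbF.
  - by move=> a b; rewrite /e' /delete /= !inE => /and3P[-> -> /eD/andP[-> ->]].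
  - by apply: weak_drawing_sub wd => a b /and3P[].
have common v w : e v w -> 2 < #|nbr e v :&: nbr e w|.
  move=> evw; rewrite ltnNge; apply/negP => com.
  have [vD wD] := andP (eD _ _ evw).
  have := vol_contract_edge es ei evw vD wD; set e' := contract_edge v w e => volv.
  have Dv : #|D| = (#|D :\ w|).+1 by rewrite (cardsD1 w) wD.
  have eD' : supported (D :\ w) e'.
    move=> a b; rewrite /e' /contract_edge /= !inE => /and3P[-> -> /=] /or3P[/eD//||].
      by case/and3P => /eqP-> _ /eD/andP[_ ->]; rewrite vD.
    by case/and3P => /eqP-> _ /eD/andP[-> _]; rewrite vD.
  suff H : vol (D :\ w) e' + 3 <= 6 * #|D :\ w| by lia.
  apply: IH => //; first by have := volN (D :\ w) e'; rewrite /N in size_le *; nia.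
  - apply/set0Pn; exists v; rewrite !inE vD andbT.
    by apply: contraTneq evw => ->; rewrite ei.
  - exact: contract_edge_sym.
  - exact: contract_edge_irr.
  - exact: weak_drawing_contract_edge wd.
(* In the sparse case the average degree is below 6, giving a vertex of degree 4 or 5. In the dense
   case deleting an edge keeps [vol] at least [6 * #|D| - 2], still a counterexample. *)
have [sparse|dense] := leqP (vol D e) (6 * #|D| - 1).
  have [v vD deg5] : exists2 v, v \in D & #|nbr e v| <= 5.
    case: (boolP [exists v in D, #|nbr e v| <= 5]) => [/exists_inP//|/exists_inPn none].
    have : \sum_(v in D) 6 <= vol D e.
      by apply: leq_sum => v /none; rewrite -ltnNge.
    by rewrite sum_nat_const mulnC; lia.
  apply: (dense_nbhd_no_drawing (v := v) es ei wd); first by rewrite deg4.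
  by move=> w /common.
have [x [y exy]] : exists x y, e x y.
  have [x xD] : exists x, x \in D by apply/set0Pn.
  have /card_gt0P[y] : 0 < #|nbr e x| by apply: leq_trans (deg4 _ xD).
  by rewrite inE => exy; exists x, y.
have [xD yD] := andP (eD _ _ exy).
have := vol_delete_edge es ei exy xD yD; set e' := delete_edge x y e => vole.
have vole' : vol D e' < vol D e.
  rewrite /vol (big_setD1 x) // [ltnRHS](big_setD1 x) //= -addSn; apply: leq_add.
    apply/proper_card/properP; split.
      by apply/subsetP => b; rewrite !inE => /and3P[].
    by exists y; rewrite !inE ?exy // /e' /delete_edge /= !eqxx andbF.
  by apply: leq_sum => a _; apply/subset_leq_card/subsetP => b; rewrite !inE => /and3P[].
suff H : vol D e' + 3 <= 6 * #|D| by lia.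
apply: IH => //; first by lia.
- move=> a b; rewrite /e' /delete_edge /= es; congr (_ && _); rewrite andbC.
  by rewrite [(b == y) && _]andbC [(b == x) && _]andbC.
- by move=> a; rewrite /e' /delete_edge /= ei.
- by move=> a b /and3P[/eD].
- by apply: weak_drawing_sub wd => a b /and3P[].
Qed.
End MaderBound.

(** * The crossing lemma *)

Section Sampling.
Variables (V : finType).

(** For a uniformly random [f] this is a random set keeping each vertex independently with
    probability [1 / q.+1]; expectations become sums over all [f]. *)
Definition zeros q (f : {ffun V -> 'I_q.+1}) : {set V} := [set x | f x == ord0].

Lemma card_zeros q (A : {set V}) :
  #|[set f : {ffun V -> 'I_q.+1} | A \subset zeros f]| * q.+1 ^ #|A| = q.+1 ^ #|V|.
Proof.
pose F x : pred 'I_q.+1 := if x \in A then pred1 ord0 else predT.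
have -> : #|[set f : {ffun V -> 'I_q.+1} | A \subset zeros f]| = #|family F|.
  apply: eq_card => f; rewrite inE; apply/subsetP/familyP => [sub x|fam x xA].
    by rewrite /F; case: ifP => // /sub; rewrite inE.
  by have := fam x; rewrite /F xA inE /= inE.
have -> : #|family F| = \prod_x #|F x|.
  by rewrite card_family foldrE big_map big_enum.
rewrite (bigID (mem A)) /= big1 ?mul1n => [|x xA]; last by rewrite /F xA card1.
rewrite (eq_bigr (fun=> q.+1)) => [|x xA]; last by rewrite /F (negPf xA) cardT size_enum_ord.
rewrite prod_nat_const -expnD; congr (_ ^ _).
by rewrite addnC -(cardC A).
Qed.

Lemma sum_card_zeros q (I : finType) (X : {set I}) (A : I -> {set V}) k :
  (forall i, i \in X -> #|A i| = k) ->
  (\sum_(f : {ffun V -> 'I_q.+1}) #|[set i in X | A i \subset zeros f]|) * q.+1 ^ k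
  = #|X| * q.+1 ^ #|V|.
Proof.
move=> Ak.
have -> : \sum_(f : {ffun V -> 'I_q.+1}) #|[set i in X | A i \subset zeros f]| =
    \sum_(i in X) #|[set f : {ffun V -> 'I_q.+1} | A i \subset zeros f]|.
  have E (f : {ffun V -> 'I_q.+1}) : #|[set i in X | A i \subset zeros f]| =
      \sum_(i in X) (if A i \subset zeros f then 1 else 0).
    by rewrite -sum1dep_card big_mkcondr.
  rewrite (eq_bigr _ (fun f _ => E f)) exchange_big /=; apply: eq_bigr => i _.
  by rewrite -big_mkcond sum1dep_card.
rewrite big_distrl /= (eq_bigr (fun=> q.+1 ^ #|V|)) ?sum_nat_const // => i iX.
by rewrite -(Ak i iX) card_zeros.
Qed.

Variables (M : {set V * V}) (conf : rel (V * V)) (K : nat).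
Hypothesis M_irr : forall e, e \in M -> e.1 != e.2.
Hypothesis conf_indep : forall e1 e2, conf e1 e2 ->
  [/\ e1 \in M, e2 \in M & uniq [:: e1.1; e1.2; e2.1; e2.2]].
Hypothesis conf_le : forall e1, #|[set e2 | conf e1 e2]| <= K.
Hypothesis planar : forall (S : {set V}) (F : {set V * V}),
  F \subset M -> (forall e, e \in F -> (e.1 \in S) && (e.2 \in S)) ->
  (forall e1 e2, e1 \in F -> e2 \in F -> ~~ conf e1 e2) -> #|F| <= 3 * #|S|.

(** An edge, a vertex and a conflict survive sampling with probability [p ^ 2], [p] and [p ^ 4],
    where [p = 1 / q.+1]. Taking expectations in [local] and multiplying by [q.+1 ^ 4] gives the
    inequality. *)
Lemma crossing_lemma q : #|M| * q.+1 ^ 2 <= 3 * #|V| * q.+1 ^ 3 + K * #|M|.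
Proof.
pose A1 (e : V * V) := [set e.1; e.2].
pose A2 (c : (V * V) * (V * V)) := A1 c.1 :|: A1 c.2.
pose X := [set c | conf c.1 c.2].
have X_le : #|X| <= K * #|M|.
  have -> : #|X| = \sum_(e1 in M) #|[set e2 | conf e1 e2]|.
    under [RHS]eq_bigr => e1 _ do rewrite -sum1dep_card.
    rewrite pair_big_dep /= -sum1dep_card; apply: eq_bigl => c.
    by case cc : (conf _ _); rewrite ?andbF //; have [-> _ _] := conf_indep cc.
  by rewrite mulnC -sum_nat_const; apply: leq_sum => e1 _; apply: conf_le.
have A1_card e : e \in M -> #|A1 e| = 2 by move=> /M_irr ne; rewrite cards2 ne.
have A2_card c : c \in X -> #|A2 c| = 4.
  rewrite inE => cc; have [m1 m2 un] := conf_indep cc.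
  rewrite cardsU !A1_card // (_ : _ :&: _ = set0) ?cards0 //.
  apply/setP => x; rewrite !inE; apply/negbTE/negP.
  move: un; rewrite /= !inE !negb_or => /and4P[/and3P[_ n1 n2] /andP[n3 n4] _ _].
  by case/andP => /orP[]/eqP-> ; rewrite ?(negPf n1) ?(negPf n2) ?(negPf n3) ?(negPf n4).
have local (f : {ffun V -> 'I_q.+1}) : #|[set e in M | A1 e \subset zeros f]| <=
    3 * #|[set x in setT | [set x] \subset zeros f]| + #|[set c in X | A2 c \subset zeros f]|.
  (* Removing the first edge of every surviving conflict leaves a conflict-free set, to which
     [planar] applies. *)
  set MS := [set e in M | _]; set XS := [set c in X | _].
  rewrite -(cardsID [set c.1 | c in XS] MS) addnC; apply: leq_add; last first.
    by apply: leq_trans (subset_leq_card (subsetIr _ _)) (leq_imset_card _ _).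
  apply: leq_trans (planar (S := zeros f) _ _ _) _.
  - by apply/subsetP => e; rewrite !inE => /and3P[].
  - by move=> e /setDP[]; rewrite inE subUset !sub1set => /andP[].
  - move=> e1 e2 /setDP[+ nX] /setDP[+ _]; rewrite !inE => /andP[m1 s1] /andP[m2 s2].
    apply: contra nX => cc; apply/imsetP; exists (e1, e2) => //.
    by rewrite !inE cc /A2 subUset s1 s2.
  - rewrite leq_mul2l /= subset_leq_card //; apply/subsetP => x xz.
    by rewrite !inE sub1set.
have := leq_sum (index_enum {ffun V -> 'I_q.+1}) (P := xpredT) (fun f _ => local f); rewrite big_split -big_distrr /= => H.
have E1 := sum_card_zeros q A1_card; have E2 := sum_card_zeros q A2_card.
have E3 : _ = #|[set: V]| * _ := sum_card_zeros (k := 1) q (fun x _ => cards1 x).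
rewrite cardsT in E3; move: H E1 E2 E3.
set a := \sum_f _; set b := \sum_f _; set c := \sum_f _ => H E1 E2 E3.
have q0 : 0 < q.+1 ^ #|V| by rewrite expn_gt0.
rewrite -(leq_pmul2r q0); apply: (@leq_trans (3 * #|V| * q.+1 ^ 3 * q.+1 ^ #|V| + #|X| * q.+1 ^ #|V|)).
  have := leq_mul H (leqnn (q.+1 ^ 4)); rewrite mulnDl E2.
  rewrite (_ : a * _ = #|M| * q.+1 ^ #|V| * q.+1 ^ 2); last by rewrite -E1; ring.
  rewrite (_ : 3 * b * _ = 3 * (#|V| * q.+1 ^ #|V|) * q.+1 ^ 3); last by rewrite -E3; ring.
  rewrite [X in X <= _ -> _]mulnAC; congr (_ <= _ + _); ring.
by rewrite mulnDl leq_add2l leq_mul2r X_le orbT.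
Qed.
End Sampling.

(** * Choice of the sampling probability *)

Section Optimum.
Local Open Scope ring_scope.

Lemma density_optimum (R : realType) (m n K : nat) :
  (forall q, m * q.+1 ^ 2 <= 3 * n * q.+1 ^ 3 + K * m)%N ->
  m%:R <= 8 * Num.sqrt ((K + 1)%N%:R : R) * n%:R.
Proof.
move=> H; set t := Num.sqrt _.
have t2 : t ^+ 2 = K%:R + 1 by rewrite sqr_sqrtr ?ler0n // natrD.
have K0 : 0 <= K%:R :> R by apply: ler0n.
have t1 : 1 <= t.
  by rewrite -[leLHS]sqrtr1 ler_wsqrtr // natrD; lra.
have s0 : 0 <= 2 * t by lra.
have /andP[] := truncn_itv s0; set p := Num.truncn _ => px xp.
have p1 : (0 < p)%N by rewrite -(ltr_nat R); move: xp; rewrite -natr1; lra.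
have := H p.-1; rewrite (prednK p1) -(ler_nat R) !(natrD, natrX, natrM) => {}H.
move: px xp H; rewrite -natr1; set x := p%:R => px xp H.
have x1 : 1 <= x by rewrite ler1n.
have d_ge0 : 0 <= 2 * t - x by lra.
(* At [x = 2 * t] the right side exceeds the left by [8 * t], which absorbs the rounding of [x] to
   an integer: the difference is written with non-negative terms in [d = 2 * t - x], [1 - d] and
   [2 * t - 2]. *)
have key : 3 * x ^+ 3 <= 8 * t * (x ^+ 2 - K%:R).
  have -> : K%:R = t ^+ 2 - 1 by rewrite t2; lra.
  rewrite -subr_ge0 (_ : _ - _ = 2 * t * ((2 * t - x) * (2 * t - 2) +
    (5 * (1 - (2 * t - x)) * (2 * t - x) + 3 * (1 - (2 * t - x)) + 1)) + 3 * (2 * t - x) ^+ 3); last by ring.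
  have [u_ge0 w_ge0] : 0 <= 1 - (2 * t - x) /\ 0 <= 2 * t - 2 by split; lra.
  move: (2 * t - x) (2 * t - 2) d_ge0 u_ge0 w_ge0 => d w d0 u0 w0.
  apply: addr_ge0; apply: mulr_ge0 => //; last exact: exprn_ge0.
  by have := mulr_ge0 d0 w0; have := mulr_ge0 u0 d0; lra.
have gap : 0 < x ^+ 2 - K%:R.
  have : 0 < 8 * t * (x ^+ 2 - K%:R).
    by apply: lt_le_trans key; rewrite mulr_gt0 // exprn_gt0 //; lra.
  by rewrite pmulr_rgt0 //; lra.
rewrite -subr_ge0 -(pmulr_lge0 _ gap) mulrBl subr_ge0.
have nk : 3 * n%:R * x ^+ 3 <= 8 * t * n%:R * (x ^+ 2 - K%:R).
  rewrite (mulrAC 3) (mulrAC (8 * t)); apply: ler_wpM2r => //; exact: ler0n.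
by apply: le_trans nk; move: H; lra.
Qed.
End Optimum.

(** * Curves of a drawing *)

Section CompactConnected.
Local Open Scope classical_set_scope.
Local Open Scope ring_scope.
Variable R : realType.

Lemma ball_epsclose (eps : R) (a b : 'rV[R]_2) : 0 < eps ->
  ball a eps b <-> epsclose eps a b.
Proof.
move=> eps0; split=> [[_ H]|/forallP H]; first by apply/forallP => j; apply: H.
by split=> // i j; rewrite (ord1 i); apply: H.
Qed.

Lemma compact_far (T : pseudoMetricType R) (A B : set T) :
  compact A -> topology_structure.closed B -> A `&` B = classical_sets.set0 ->
  \forall e \near 0^'+, forall a b, A a -> B b -> ~ ball a e b.
Proof.
move=> /compact_near_coveringP cA cB AB.
have H : \forall e \near 0^'+, A `<=` (fun a => forall b, B b -> ~ ball a e b).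
  apply: cA => x Ax.
  have : nbhs x (~` B).
    apply: open_nbhs_nbhs; split; first exact: closed_openC.
    by move=> Bx; have : (A `&` B) x by []; rewrite AB.
  move/nbhs_ballP => [d /= d0 sub].
  exists (ball x (d / 2), [set e | e < d / 2]) => /=.
    split; first by apply: nbhsx_ballx; rewrite divr_gt0.
    by apply: nbhs_right_lt; rewrite divr_gt0.
  move=> [y e] /= [xy ed] b Bb yb; apply: (sub b) => //.
  rewrite [d]splitr; apply: ball_triangle xy _.
  by apply: le_ball yb; apply: ltW.
by apply: filterS H => e He a b /He; apply.
Qed.

(** The set of points of [A] reachable from [a] by chains inside [A] is both open and closed
    relative to [A]. *)
Lemma connected_chain (A : set 'rV[R]_2) (eps : R) a b : 0 < eps ->
  connected A -> A a -> A b ->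
  exists s, path (epsclose eps) a (rcons s b) /\ {in s, forall z, A z}.
Proof.
move=> eps0 cA Aa Ab.
pose B : set 'rV[R]_2 := fun z => A z /\
  exists s, path (epsclose eps) a (rcons s z) /\ {in s, forall z, A z}.
have step y z : B y -> A z -> epsclose eps y z -> B z.
  move=> [Ay [s [ps sA]]] Az yz; split=> //; exists (rcons s y).
  rewrite -cats1 cat_path last_rcons ps /= yz; split=> // t.
  by rewrite mem_rcons inE => /predU1P[->|/sA].
have Baa : B a.
  by split=> //; exists [::]; rewrite /= (ball_epsclose _ _ eps0).1 //; exact: ballxx.
suff BA : B = A by have := Ab; rewrite -{1}BA => -[].
apply: cA; first by exists a.
- exists (\bigcup_(y in B) (ball y eps)°).
    by apply: bigcup_open => y _; exact: open_interior.
  apply/seteqP; split=> [z Bz|z [Az [y By /interior_subset yz]]].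
    by split; [case: Bz | exists z => //; exact: nbhsx_ballx].
  by apply: step By Az _; apply/ball_epsclose.
- exists (~` (\bigcup_(y in A `\` B) (ball y eps)°)).
    by apply: open_closedC; apply: bigcup_open => y _; exact: open_interior.
  apply/seteqP; split=> [z Bz|z [Az nz]].
    split; first by case: Bz.
    move=> [y [Ay nBy] /interior_subset yz]; apply: nBy; apply: step Bz Ay _.
    by rewrite epsclose_sym; apply/ball_epsclose.
  apply: contrapT => nBz; apply: nz; exists z => //; exact: nbhsx_ballx.
Qed.
End CompactConnected.

(** * Arcs of edges and their concatenation along paths *)

Section Trails.
Local Open Scope classical_set_scope.
Local Open Scope ring_scope.
Variables (T : finType) (e : rel T) (pos : T -> 'rV[RR]_2) (gam : T -> T -> RR -> 'rV[RR]_2).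
Hypothesis dr : drawing e pos gam.

Definition arc x y : set 'rV[RR]_2 := gam x y @` `[0, 1].
Fixpoint trail x s : set 'rV[RR]_2 :=
  if s is y :: s' then arc x y `|` trail y s' else classical_sets.set0.
Definition steps x (s : seq T) := zip (x :: s) s.

Lemma arc_ends x y : e x y -> arc x y (pos x) /\ arc x y (pos y).
Proof.
case: dr => _ H _ _ /H [_ _ g0 g1 _].
by split; [exists 0 | exists 1]; rewrite //= in_itv /= ?lexx ?ler01.
Qed.

Lemma arc_compact x y : e x y -> compact (arc x y).
Proof.
case: dr => _ H _ _ /H [gc _ _ _ _].
by apply: continuous_compact => //; apply: segment_compact.
Qed.

Lemma arc_connected x y : e x y -> connected (arc x y).
Proof.
case: dr => _ H _ _ /H [gc _ _ _ _].
by apply: connected_continuous_connected => //; apply: segment_connected.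
Qed.

Lemma trail_compact x s : path e x s -> compact (trail x s).
Proof.
elim: s x => [|y s IH] x /=; first by move=> _; apply: compact0.
by move=> /andP[xy ps]; apply: compactU; [apply: arc_compact | apply: IH].
Qed.

Lemma trail_chain eps x s y : 0 < eps -> path e x (rcons s y) ->
  exists c, path (epsclose eps) (pos x) (rcons c (pos y)) /\
    {in pos x :: rcons c (pos y), forall p, trail x (rcons s y) p}.
Proof.
move=> eps0; have arcP u v : e u v -> exists c,
    path (epsclose eps) (pos u) (rcons c (pos v)) /\
    {in pos u :: rcons c (pos v), forall p, arc u v p}.
  move=> uv; have [au av] := arc_ends uv.
  have [c [pc cA]] := connected_chain eps0 (arc_connected uv) au av.
  exists c; split=> // p; rewrite inE mem_rcons inE => /or3P[/eqP->|/eqP->|/cA] //.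
elim: s x => [|z s IH] x /=.
  rewrite andbT => /arcP[c [pc cA]]; exists c; split=> // p /cA ?; by left.
move=> /andP[/arcP[c [pc cA]] /IH[c' [pc' cA']]].
exists (rcons c (pos z) ++ c'); rewrite rcons_cat cat_path last_rcons pc pc'; split=> // p.
rewrite -cat_cons mem_cat => /orP[/cA|pin]; first by left.
by right; apply: cA'; rewrite inE pin orbT.
Qed.

Lemma trail_step x s p : trail x s p -> exists2 c, c \in steps x s & arc c.1 c.2 p.
Proof.
elim: s x => [|y s IH] x //= [axy|/IH[c cs cp]]; first by exists (x, y); rewrite ?inE ?eqxx.
by exists c; rewrite // inE cs orbT.
Qed.

Lemma steps_edge x s c : path e x s -> c \in steps x s -> e c.1 c.2.
Proof.
elim: s x => [|y s IH] x //= /andP[xy ps]; rewrite inE => /predU1P[-> //|].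
exact: IH.
Qed.

Lemma steps_mem x s c : c \in steps x s -> c.1 \in x :: s /\ c.2 \in x :: s.
Proof.
elim: s x => [|y s IH] x //=; rewrite inE => /predU1P[-> | /IH[c1 c2]] /=.
  by rewrite !inE !eqxx ?orbT.
by split; rewrite in_cons ?c1 ?c2 orbT.
Qed.

Lemma steps_rcons x s y c : c \in steps x (rcons s y) ->
  [\/ c.1 \in s, c.2 \in s | c = (x, y)].
Proof.
elim: s x => [|z s IH] x /=.
  by rewrite inE => /eqP ->; apply: Or33.
rewrite inE => /predU1P[-> | /IH[c1|c2|->]] /=.
- by apply: Or32; rewrite inE eqxx.
- by apply: Or31; rewrite inE c1 orbT.
- by apply: Or32; rewrite inE c2 orbT.
- by apply: Or31; rewrite inE eqxx.
Qed.

Lemma size_steps x s : size (steps x s) = size s.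
Proof. by rewrite size2_zip /=. Qed.

(** Were [p] an endpoint of the first arc, a vertex would lie on the arc of an edge not containing
    it: inside, which a drawing forbids, or at an end, against injectivity of [pos]. *)
Lemma arc_inner x y z w p : e x y -> e z w -> uniq [:: x; y; z; w] ->
  arc x y p -> arc z w p -> on_edge e gam [set x; y]%SET p.
Proof.
case: dr => pinj H avoid _ xy zw un [t /=]; rewrite in_itv /= => /andP[t0 t1] gt.
move=> [u /=]; rewrite in_itv /= => /andP[u0 u1] gu.
have [[_ _ gxy0 gxy1 _] [_ _ gzw0 gzw1 _]] := (H _ _ xy, H _ _ zw).
have notpos a : a \in [:: x; y] -> p <> pos a.
  move=> axy pa.
  have aN : a != z /\ a != w.
    move: un axy; rewrite /= !inE !negb_or => /and4P[/and3P[_ xz xw] /andP[yz yw] _ _].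
    by case/orP => /eqP->.
  move: u0; rewrite le_eqVlt => /predU1P[u0|u0].
    by case: aN => /eqP + _; apply; apply: pinj; rewrite -pa -gu -u0.
  move: u1; rewrite le_eqVlt => /predU1P[u1|u1].
    by case: aN => _ /eqP; apply; apply: pinj; rewrite -pa -gu u1.
  by apply: (avoid z w a u zw u0 u1); rewrite gu.
exists x, y; split=> //; exists t; split=> //.
- rewrite lt_neqAle t0 andbT; apply/eqP => E; apply: (notpos x); first by rewrite inE eqxx.
  by rewrite -gt -E.
- rewrite lt_neqAle t1 andbT; apply/eqP => E; apply: (notpos y); first by rewrite !inE eqxx orbT.
  by rewrite -gt E.
Qed.
End Trails.

(** * Conflicts between the edges of the minor *)

Lemma card_le_fibres (I : finType) (J : eqType) (Y : {set I}) (g : I -> J) (L : seq J) m :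
  (forall y, y \in Y -> g y \in L) ->
  (forall E, #|[set y in Y | g y == E]| <= m) -> #|Y| <= size L * m.
Proof.
move=> gL fib; elim: L Y gL fib => [|E L IH] Y gL fib.
  rewrite leqn0 cards_eq0; apply/eqP/setP => y; rewrite inE.
  by apply/negP => /gL.
rewrite -(cardsID [set y | g y == E] Y) mulSn; apply: leq_add.
  by have := fib E; congr (_ <= _); apply: eq_card => y; rewrite !inE.
apply: IH => [y|E']; first by rewrite !inE => /andP[nE /gL]; rewrite inE (negPf nE).
by apply: leq_trans (fib E'); apply/subset_leq_card/subsetP => y; rewrite !inE => /andP[/andP[_ ->] ->].
Qed.

Section Conflicts.
Local Open Scope ring_scope.
Variables (T : finType) (e : rel T) (k r n : nat) (eH : rel 'I_n).
Variables (pos : T -> 'rV[RR]_2) (gam : T -> T -> RR -> 'rV[RR]_2).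
Variables (ch : 'rV[RR]_2 -> {set T}) (phi : 'I_n -> T) (P : 'I_n -> 'I_n -> seq T).
Hypothesis ei : irreflexive e.
Hypothesis dr : drawing e pos gam.
Hypothesis ch_on : forall p, crossing e gam p -> on_edge e gam (ch p) p.
Hypothesis ch_le : forall E (s : seq 'rV[RR]_2), uniq s ->
  (forall p, p \in s -> crossing e gam p /\ ch p = E) -> (size s <= k)%N.
Hypothesis phi_inj : injective phi.
Hypothesis pathP : forall u v : 'I_n, (u < v)%N -> eH u v ->
  [/\ path e (phi u) (rcons (P u v) (phi v)), uniq (P u v),
      (size (P u v) <= 2 * r)%N & forall w, phi w \notin P u v].
Hypothesis P_disj : forall u v u' v' : 'I_n,
  (u < v)%N -> eH u v -> (u' < v')%N -> eH u' v' ->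
  (u, v) != (u', v') -> forall x, x \in P u v -> x \notin P u' v'.

Definition edges : {set 'I_n * 'I_n} := [set a : 'I_n * 'I_n | (a.1 < a.2)%N && eH a.1 a.2].
Definition walk (a : 'I_n * 'I_n) := rcons (P a.1 a.2) (phi a.2).
Definition curve a := trail gam (phi a.1) (walk a).
Definition walk_edges a := [seq [set c.1; c.2] | c <- steps (phi a.1) (walk a)].
Definition indep (a b : 'I_n * 'I_n) := uniq [:: a.1; a.2; b.1; b.2].

Lemma edgesP a : a \in edges -> (a.1 < a.2)%N /\ eH a.1 a.2.
Proof. by rewrite inE => /andP. Qed.

Lemma walk_path a : a \in edges -> path e (phi a.1) (walk a).
Proof. by move=> /edgesP[lt ea]; case: (pathP lt ea). Qed.

Lemma phi_notin a w : a \in edges -> phi w \notin P a.1 a.2.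
Proof. by move=> /edgesP[lt ea]; case: (pathP lt ea). Qed.

Lemma edge_disj a b x : a \in edges -> b \in edges -> 
  x \in P a.1 a.2 -> x \in P b.1 b.2 -> a = b.
Proof.
move=> /edgesP[lta ea] /edgesP[ltb eb] xa xb; apply/eqP/negPn/negP => ab.
have ab' : (a.1, a.2) != (b.1, b.2) by rewrite -!surjective_pairing.
by have := P_disj lta ea ltb eb ab' xa; rewrite xb.
Qed.

Lemma walk_mem a x : (x \in phi a.1 :: walk a) =
  [|| x == phi a.1, x == phi a.2 | x \in P a.1 a.2].
Proof. by rewrite inE mem_rcons inE. Qed.

Lemma walk_disj a b x : a \in edges -> b \in edges -> indep a b ->
  x \in phi a.1 :: walk a -> x \notin phi b.1 :: walk b.
Proof.
move=> aE bE un; rewrite !walk_mem.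
have := un; rewrite /indep /= !inE !negb_or => /and4P[/and3P[_ n1 n2] /andP[n3 n4] _ _].
case/or3P => [/eqP->|/eqP->|xa].
- by rewrite !(inj_eq phi_inj) (negPf n1) (negPf n2) phi_notin.
- by rewrite !(inj_eq phi_inj) (negPf n3) (negPf n4) phi_notin.
apply/and3P; split; apply/negP; move=> xb.
- by move: (phi_notin b.1 aE); rewrite -(eqP xb) xa.
- by move: (phi_notin b.2 aE); rewrite -(eqP xb) xa.
by move: n1; rewrite (edge_disj aE bE xa xb) eqxx.
Qed.

(** An inner vertex of a walk determines the walk, and every step touches one unless the walk is a
    single edge. *)
Lemma walk_edges_owner a b X : a \in edges -> b \in edges ->
  X \in walk_edges a -> X \in walk_edges b -> a = b.
Proof.
move=> aE bE /mapP[c ca ->] /mapP[d db] /setP cd.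
have inner a' b' (c' d' : T * T) x : a' \in edges -> b' \in edges ->
    d' \in steps (phi b'.1) (walk b') -> [set c'.1; c'.2] =i [set d'.1; d'.2] ->
    x \in [set c'.1; c'.2] -> x \in P a'.1 a'.2 -> a' = b'.
  move=> aE' bE' db' cd' xc xa; apply: edge_disj (xa) _ => //.
  have := steps_mem db'; rewrite !walk_mem => -[d1 d2].
  move: xc; rewrite cd' !inE => /orP[]/eqP E; move: d1 d2; rewrite -E => d1 d2.
    by case/or3P: d1 => // /eqP xE; move: (xa); rewrite xE (negPf (phi_notin _ aE')).
  by case/or3P: d2 => // /eqP xE; move: (xa); rewrite xE (negPf (phi_notin _ aE')).
have dc : [set d.1; d.2] =i [set c.1; c.2] by move=> x; rewrite cd.
case: (steps_rcons ca) => [c1|c2|cE].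
- by apply: inner aE bE db cd _ c1; rewrite !inE eqxx.
- by apply: inner aE bE db cd _ c2; rewrite !inE eqxx orbT.
case: (steps_rcons db) => [d1|d2|dE].
- by apply/esym/(inner _ _ d c d.1) => //; rewrite !inE eqxx.
- by apply/esym/(inner _ _ d c d.2) => //; rewrite !inE eqxx orbT.
(* Both walks are single edges here: [phi] is injective, and the order of the two ends rules out a
   swap. *)
have := cd (phi a.1); have := cd (phi a.2); have := dc (phi b.1); have := dc (phi b.2).
rewrite cE dE /= !inE !eqxx !(inj_eq phi_inj) ?orbT /= => h4 h3 h2 h1.
have [lta _] := edgesP aE; have [ltb _] := edgesP bE.
case: (a) (b) lta ltb h1 h2 h3 h4 => [u v] [u' v'] /= lta ltb.
case: (eqVneq u u') => [uu|nu] /=.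
  case: (eqVneq v v') => [->|nv]; first by rewrite uu.
  rewrite /= orbF => _ /esym/eqP vu.
  by move: lta; rewrite uu vu ltnn.
move=> /esym/eqP uv'; case: (eqVneq v u') => [vu|nvu] /=.
  by move: lta ltb; rewrite uv' vu => h /(ltn_trans h); rewrite ltnn.
by move=> /esym/eqP vv'; move: lta; rewrite uv' vv' ltnn.
Qed.

Lemma curve_meet a b p : a \in edges -> b \in edges -> indep a b ->
  curve a p -> curve b p -> exists2 X, X \in walk_edges a & on_edge e gam X p.
Proof.
move=> aE bE un /trail_step[c ca cp] /trail_step[d db dp].
exists [set c.1; c.2]; first by apply/mapP; exists c.
have [ec ed] := (steps_edge (walk_path aE) ca, steps_edge (walk_path bE) db).
apply: (arc_inner dr ec ed _ cp dp).
have [c1 c2] := steps_mem ca; have [d1 d2] := steps_mem db.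
have ne x y : x \in phi a.1 :: walk a -> y \in phi b.1 :: walk b -> x != y.
  by move=> /(walk_disj aE bE un) + yb; apply: contraNneq => ->.
have irr x y : e x y -> x != y by move=> exy; apply/eqP => E; rewrite E ei in exy.
by rewrite /= !inE !negb_or (irr _ _ ec) (irr _ _ ed) !ne.
Qed.

Lemma indep_sym a b : indep a b = indep b a.
Proof.
by rewrite /indep -(perm_uniq (permEl (perm_catC [:: a.1; a.2] [:: b.1; b.2]))).
Qed.

Lemma indep_neq a b : indep a b -> a <> b.
Proof. by move=> + E; rewrite E /indep /= !inE eqxx ?orbT. Qed.

Lemma is_edge_on X p : on_edge e gam X p -> is_edge e X.
Proof. by case=> x [y [exy -> _]]; exists x, y. Qed.

(** The point lies on an edge of each walk, and these differ. The charged edge also passes through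
    it, so it is one of the two, as no three edges cross at a point. *)
Lemma meet_crossing a b p : a \in edges -> b \in edges -> indep a b ->
  curve a p -> curve b p ->
  [/\ crossing e gam p & ch p \in walk_edges a ++ walk_edges b].
Proof.
move=> aE bE un ap bp.
have [X Xa Xp] := curve_meet aE bE un ap bp.
have [Y Yb Yp] : exists2 Y, Y \in walk_edges b & on_edge e gam Y p.
  by apply: curve_meet bE aE _ bp ap; rewrite indep_sym.
have XY : X <> Y.
  by move=> E; apply: (indep_neq un); apply: walk_edges_owner Xa _; rewrite // E.
have cr : crossing e gam p by exists X, Y.
split=> //; have chp := ch_on cr.
case: (eqVneq (ch p) X) => [->|nX]; first by rewrite mem_cat Xa.
case: (eqVneq (ch p) Y) => [->|nY]; first by rewrite mem_cat Yb orbT.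
case: dr => _ _ _ no3; exfalso.
by apply: (no3 _ _ _ p (is_edge_on Xp) (is_edge_on Yp) (is_edge_on chp)) => // E;
   [move: nX | move: nY]; rewrite E eqxx.
Qed.

(* The intersection is attributed to [a], whose edge it is charged to; two
   intersecting curves are thus in conflict in at least one direction. *)
Definition charged a b : Prop :=
  [/\ a \in edges, b \in edges, indep a b &
      exists p, [/\ curve a p, curve b p & ch p \in walk_edges a]].

Definition conf : rel ('I_n * 'I_n) := [rel a b | `[< charged a b >]].

(** The walk of [a] has at most [2 * r + 1] edges. Choosing a charged point for each conflicting
    [b], at most [k] of them are charged to a given edge, and distinct [b] give distinct points,
    since a common point would lie on three edges. *)
Lemma conf_le a : (#|[set b | conf a b]| <= (2 * r + 1) * k)%N.
Proof.
case aE : (a \in edges); last first.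
  rewrite (_ : [set b | _] = set0) ?cards0 //; apply/setP => b; rewrite !inE.
  by apply/negP => /asboolP[]; rewrite aE.
have /boolp.choice[f fP] b : exists p, conf a b ->
    [/\ curve a p, curve b p & ch p \in walk_edges a].
  case: (pselect (conf a b)) => [|nc]; last by exists 0.
  by move=> /asboolP[_ _ _ [p pP]]; exists p.
apply: (@leq_trans (size (walk_edges a) * k)); last first.
  rewrite leq_mul2r size_map size_steps size_rcons addn1 ltnS.
  by have [lt ea] := edgesP aE; have [_ _ -> _] := pathP lt ea; rewrite orbT.
apply: (card_le_fibres (g := ch \o f)) => [b|E]; first by rewrite inE => /fP[].
rewrite cardE -(size_map f); apply: (ch_le (E := E)).
  rewrite map_inj_in_uniq ?enum_uniq // => b b'; rewrite !mem_enum !inE /=.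
  move=> /andP[cb /eqP chb] /andP[cb' _] fbb'.
  have [ap bp cha] := fP _ cb; have [_ bp' _] := fP _ cb'; rewrite -fbb' in bp'.
  move/asboolP: cb => [_ bE un _]; move/asboolP: cb' => [_ bE' un' _].
  have [Y Yb Yp] : exists2 Y, Y \in walk_edges b & on_edge e gam Y (f b).
    by apply: curve_meet bE aE _ bp ap; rewrite indep_sym.
  have [Y' Yb' Yp'] : exists2 Y, Y \in walk_edges b' & on_edge e gam Y (f b).
    by apply: curve_meet bE' aE _ bp' ap; rewrite indep_sym.
  have [X Xa Xp] := curve_meet aE bE un ap bp.
  have XY : X <> Y.
    by move=> E'; apply: (indep_neq un); apply: walk_edges_owner Xa _; rewrite // E'.
  have XY' : X <> Y'.
    by move=> E'; apply: (indep_neq un'); apply: walk_edges_owner Xa _; rewrite // E'.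
  case: (eqVneq Y Y') => [YY'|/eqP YY']; first by apply: walk_edges_owner Yb _; rewrite ?YY'.
  case: dr => _ _ _ no3; exfalso.
  exact: (no3 _ _ _ (f b) (is_edge_on Xp) (is_edge_on Yp) (is_edge_on Yp')).
move=> p /mapP[b]; rewrite mem_enum !inE => /andP[cb /eqP chb] ->.
have [ap bp _] := fP _ cb; move/asboolP: cb => [_ bE un _].
by have [cr _] := meet_crossing aE bE un ap bp.
Qed.

(** Independent curves in [F] are compact and disjoint, as an intersection would be charged to one
    of them. There are finitely many pairs, so one [eps] serves all. *)
Lemma conflict_free_far (F : {set 'I_n * 'I_n}) : F \subset edges ->
  (forall a b, a \in F -> b \in F -> ~~ conf a b) ->
  exists2 eps : RR, 0 < eps & forall a b p q, a \in F -> b \in F -> indep a b ->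
    curve a p -> curve b q -> ~~ epsclose eps p q.
Proof.
move=> /subsetP FE free.
have H : \forall eps \near (0^'+)%classic, forall c : ('I_n * 'I_n) * ('I_n * 'I_n),
    forall p q, [&& c.1 \in F, c.2 \in F & indep c.1 c.2] ->
    curve c.1 p -> curve c.2 q -> ~ ball p eps q.
  apply: filter_forall => -[a b] /=.
  case: (boolP [&& _, _ & _]) => [/and3P[aF bF un]|_]; last exact: nearW.
  have := @compact_far _ _ (curve a) (curve b)
    (trail_compact dr (walk_path (FE _ aF)))
    (compact_closed (@norm_hausdorff _ _) (trail_compact dr (walk_path (FE _ bF)))).
  move=> far; apply: filterS (far _) => [eps He p q _|]; first exact: He.
  apply/seteqP; split=> // p [ap bp].
  have [_] := meet_crossing (FE _ aF) (FE _ bF) un ap bp; rewrite mem_cat => /orP[] chp.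
    case/negP: (free _ _ aF bF); apply/asboolP; split; rewrite ?FE //.
    by exists p.
  case/negP: (free _ _ bF aF); apply/asboolP; split; rewrite ?FE 1?indep_sym //.
  by exists p.
have [eps [eps0 far]] := filter_ex (filterI (nbhs_right_gt (0 : RR)) H).
exists eps => // a b p q aF bF un ap bq; apply/negP => /(ball_epsclose _ _ eps0).
by apply: (far (a, b)) => //; rewrite /= aF bF.
Qed.

Lemma conflict_free_planar (S : {set 'I_n}) (F : {set 'I_n * 'I_n}) :
  F \subset edges -> (forall a, a \in F -> (a.1 \in S) && (a.2 \in S)) ->
  (forall a b, a \in F -> b \in F -> ~~ conf a b) -> (#|F| <= 3 * #|S|)%N.
Proof.
move=> FE FS free; have [eps eps0 far] := conflict_free_far FE free.
case: (eqVneq S set0) => [S0|S0].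
  rewrite leqNgt; apply/negP => /(leq_ltn_trans (leq0n _)).
  by rewrite card_gt0 => /set0Pn[a /FS]; rewrite S0 inE.
pose rho : rel 'I_n := [rel u v | ((u, v) \in F) || ((v, u) \in F)].
pose o (u v : 'I_n) := if (u < v)%N then (u, v) else (v, u).
have Flt a : a \in F -> (a.1 < a.2)%N by move=> /(subsetP FE) /edgesP[].
have rhoF u v : rho u v -> o u v \in F.
  rewrite /o => /orP[uvF|vuF]; first by rewrite (Flt _ uvF).
  by rewrite ltnNge ltnW // (Flt _ vuF).
have /boolp.choice[s sP] (c : 'I_n * 'I_n) : exists s, rho c.1 c.2 ->
    path (epsclose eps) (pos (phi c.1)) (rcons s (pos (phi c.2))) /\
    {in pos (phi c.1) :: rcons s (pos (phi c.2)), forall p, curve (o c.1 c.2) p}.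
  case: c => u v /=; case ruv : (rho u v); last by exists [::].
  have := rhoF _ _ ruv; rewrite /o; case: ifP => _ inF.
    have [c [pc cC]] := trail_chain dr eps0 (walk_path (subsetP FE _ inF)).
    by exists c.
  have [c [pc cC]] := trail_chain dr eps0 (walk_path (subsetP FE _ inF)).
  (* Curves run from the smaller end to the larger, so the opposite orientation uses the reversed
     chain. *)
  exists (rev c) => _; split.
    rewrite -rev_cons -(belast_rcons _ _ (pos (phi u))).
    rewrite -[X in path _ X _](last_rcons (pos (phi v)) c) rev_path.
    by rewrite (eq_path (e' := epsclose eps)) // => x y; apply: epsclose_sym.
  by move=> p pin; apply: cC; rewrite -mem_rev rev_cons rev_rcons.
have indl u v c : indep (u, v) c = indep (v, u) c.
  exact: perm_uniq (permEl (perm_catCA [:: u] [:: v] [:: c.1; c.2])).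
have indr u v c : indep c (u, v) = indep c (v, u).
  by rewrite indep_sym indl indep_sym.
have wd : weak_drawing eps rho.
  exists (pos \o phi), (fun u v => s (u, v)); split.
    by move=> u v /(sP (u, v))[].
  move=> a b c d x y rab rcd un xin yin.
  apply: far (rhoF _ _ rab) (rhoF _ _ rcd) _ _ _.
  - rewrite /o; case: ifP => _; case: ifP => _ //.
    + by rewrite indr.
    + by rewrite indl.
    + by rewrite indl indr.
  - exact: (sP (a, b) rab).2.
  - exact: (sP (c, d) rcd).2.
have rs : symmetric rho by move=> u v; rewrite /rho /= orbC.
have ri : irreflexive rho.
  by move=> u; rewrite /rho /= orbb; apply/negP => /Flt; rewrite ltnn.
have rS : supported S rho.
  by move=> u v /orP[] /FS /andP[/= -> ->].
have := weak_drawing_vol S0 rs ri rS wd.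
(* [rho] contains [F] and its mirror image, which are disjoint because pairs in [F] are
   increasing. *)
suff : (#|F| + #|F| <= vol S rho)%N by lia.
have -> : vol S rho = #|[set c : 'I_n * 'I_n | rho c.1 c.2]|.
  rewrite /vol; under eq_bigr => u _ do rewrite -sum1dep_card.
  rewrite pair_big_dep /= -sum1dep_card; apply: eq_bigl => c.
  by case cc : (rho _ _); rewrite ?andbF // andbT; have /andP[] := rS _ _ cc.
pose swap (c : 'I_n * 'I_n) := (c.2, c.1).
have swap_inj : injective swap by case=> [a b] [c d] [-> ->].
have swapF : #|swap @: F| = #|F| := card_imset _ swap_inj.
rewrite -{2}swapF -cardsUI (_ : F :&: _ = set0) ?cards0 ?addn0.
  apply/subset_leq_card/subsetP => c /setUP[cF|/imsetP[d dF ->]].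
    by rewrite inE /rho /= -surjective_pairing cF.
  by rewrite inE /rho /= -surjective_pairing dF orbT.
apply/setP => c; rewrite !inE; apply/negP => /andP[cF /imsetP[d dF cE]].
by have := Flt _ dF; have := Flt _ cF; rewrite cE /= => /ltnW; rewrite leqNgt => /negP.
Qed.
End Conflicts.

(** * Density of shallow topological minors *)

Local Open Scope ring_scope.

Theorem theorem2 (T : finType) (e : rel T) (k : nat) :
  symmetric e -> irreflexive e -> k_gap_planar e k ->
  forall (r n : nat) (eH : rel 'I_n),
    symmetric eH -> irreflexive eH -> shallow_top_minor e r eH ->
    density eH <= 8 * Num.sqrt (((2 * r + 1) * (k + 1))%N%:R : RR).
Proof.
move=> _ ei [pos [gam [dr [ch [ch_on ch_le]]]]] r n eH _ _.
move=> [phi [phi_inj [P [pathP P_disj]]]].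
rewrite /density; case: eqP => [_|/eqP n0]; first by rewrite mulr_ge0 ?sqrtr_ge0.
rewrite ler_pdivrMr ?ltr0n ?lt0n //.
pose cf := conf eH gam ch phi P.
have -> : num_edges eH = #|edges eH| by [].
(* The crossing argument with [K = (2 * r + 1) * k] gives this slightly stronger bound. *)
apply: (@le_trans _ _ (8 * Num.sqrt (((2 * r + 1) * k + 1)%N%:R) * n%:R)); last first.
  rewrite ler_wpM2r ?ler0n // ler_wpM2l // ler_wsqrtr // ler_nat.
  by rewrite mulnDr leq_add2l; lia.
apply: density_optimum => q; have := card_ord n; set N := #|_| => <-.
apply: (@crossing_lemma _ (edges eH) cf).
- by move=> a /edgesP[lt _]; rewrite neq_ltn lt.
- by move=> a b /asboolP[].
- by move=> a; apply: (conf_le (e := e) (pos := pos)).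
- by move=> S F; apply: (conflict_free_planar (e := e) (r := r) (pos := pos)).
Qed.
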